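(* Let $(X,d)$ be a complete metric space and $f:X\to\mathcal{I}$ an interval-valued function, $f(x)=[\underline{f}(x),\overline{f}(x)]$. Suppose that (i) $f$ is $\preccurlyeq$-lower semicontinuous and (ii) $f$ is $\preccurlyeq$-lower bounded. Then for every $\varepsilon>0$ and every $x_0\in X$ satisfying $\underline{f}(x_0)\le\inf_{x\in X}\underline{f}(x)+\varepsilon$ and $\overline{f}(x_0)\le\inf_{x\in X}\overline{f}(x)+\varepsilon$, there exists $\overline{x}\in X$ such that (a) $f(\overline{x})\preccurlyeq f(x_0)$; (b) $d(x_0,\overline{x})\le 1$; (c) for all $x\in X$ with $x\ne\overline{x}$, $f(x)+[\varepsilon d(x,\overline{x}),\varepsilon d(x,\overline{x})]\not\preccurlyeq f(\overline{x})$.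
   Context: $\mathcal{I}=\{[a,b]:a\le b,\ a,b\in\mathbb{R}\}$ is the set of closed bounded real intervals, with addition $[\underline{a},\overline{a}]+[\underline{b},\overline{b}]=[\underline{a}+\underline{b},\overline{a}+\overline{b}]$. For $A=[\underline{a},\overline{a}]$ and $B=[\underline{b},\overline{b}]$ in $\mathcal{I}$: $A\preccurlyeq B$ means $\underline{a}\le\underline{b}$ and $\overline{a}\le\overline{b}$; $A\not\preccurlyeq B$ means that $A\preccurlyeq B$ fails. An interval-valued function $f:X\to\mathcal{I}$ is written $f(x)=[\underline{f}(x),\overline{f}(x)]$ with $\underline{f},\overline{f}:X\to\mathbb{R}$, $\underline{f}\le\overline{f}$. $f$ is $\preccurlyeq$-lower semicontinuous on $X$ if for every $A\in\mathcal{I}$ the set $\{x\in X:f(x)\preccurlyeq A\}$ is closed. $f$ is $\preccurlyeq$-lower bounded if there is $A\in\mathcal{I}$ with $A\preccurlyeq f(x)$ for all $x\in X$. *)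

(* Defs.v *)
From mathcomp Require Import all_boot all_order all_algebra.
From mathcomp Require Import all_classical all_reals all_analysis.

Set Implicit Arguments.
Unset Strict Implicit.
Unset Printing Implicit Defensive.

Import Order.TTheory GRing.Theory Num.Theory.
Local Open Scope classical_set_scope.
Local Open Scope ring_scope.

(* Closed bounded real intervals, represented by their endpoints; the interval
   type of MathComp also has open and unbounded intervals. *)
Record cbitv (R : realType) := Cbitv {
  lo : R ;
  hi : R ;
  lo_le_hi : lo <= hi }.

Definition cbitv_add (R : realType) (A B : cbitv R) : cbitv R :=
  Cbitv (lerD (lo_le_hi A) (lo_le_hi B)).

Definition cbitv_pt (R : realType) (r : R) : cbitv R := Cbitv (lexx r).

Definition cbitv_le (R : realType) (A B : cbitv R) : Prop :=
  lo A <= lo B /\ hi A <= hi B.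

Definition cbitv_lsc (R : realType) (X : topologicalType)
    (f : X -> cbitv R) : Prop :=
  forall A : cbitv R, closed [set x | cbitv_le (f x) A].

Definition cbitv_lower_bounded (R : realType) (X : Type)
    (f : X -> cbitv R) : Prop :=
  exists A : cbitv R, forall x, cbitv_le A (f x).

(* The library's completeType is pointed and has no join with metricType, hence
   a predicate. The topology and the entourages of a metricType are those
   generated by the balls of mdist. *)
Definition complete_metric (R : realType) (X : metricType R) : Prop :=
  forall u : nat -> X, cauchy (u @ \oo) -> exists l : X, u @ \oo --> l.

(* Main.v *)
Require Import Defs.
From mathcomp Require Import all_boot all_order all_algebra.
From mathcomp Require Import all_classical all_reals all_analysis.
From mathcomp Require Import lra.

Set Implicit Arguments.
Unset Strict Implicit.
Unset Printing Implicit Defensive.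

Import Order.TTheory GRing.Theory Num.Theory.
Local Open Scope classical_set_scope.
Local Open Scope ring_scope.

(** The relation 'y is reached from x' given by
    f(y) + eps d(y, x) <= f(x) is a preorder, and for each x the set
    [ekeland_set f eps x] of points reached from x is closed. The
    point sought is reachable from x0, and from it nothing but itself can be
    reached.

    It is the limit of a greedy sequence: from each term, move to a reachable
    point where the upper endpoint of f is within eps / n of its infimum over
    the reachable set. A later move costs eps times the distance travelled and
    can gain at most eps / n, so everything reachable from the new term lies
    within 1 / n of it. The reachable sets are thus nested, closed, and of
    vanishing size, and by completeness they shrink to a single point. This
    point has the required minimality because whatever is reachable from it is
    in all of these sets. [exists_maximal_of_shrinking] isolates this argument
    from the intervals, and [ekeland_set_shrink] provides the greedy moves.

    Closedness is where semicontinuity is delicate: the lower endpoint need not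
    be lower semicontinuous on its own, since only the sets where both
    endpoints are bounded, by an interval, are known to be closed. The bounds
    that occur in [closed_ekeland_set] are translates of f(x), hence again
    intervals, so that this suffices.

    The bound d(x0, xbar) <= 1 holds because xbar is reachable from x0, where
    the upper endpoint is within eps of its infimum. *)

(** * A maximality principle in complete metric spaces *)

(** Choosing successive points whose reachable sets have radius 1 / (n + 1)
    gives a Cauchy sequence. Its limit stays in every reachable set, by
    closedness, and so does any point z reachable from the limit; but a point
    lying in all these sets is itself a limit of the sequence, so z is the
    limit by uniqueness. *)
Lemma exists_maximal_of_shrinking (R : realType) (X : metricType R)
    (S : X -> set X) (x0 : X) :
  complete_metric X ->
  (forall x, closed (S x)) ->
  (forall x y, S x y -> S y `<=` S x) ->
  (forall x (r : R), 0 < r ->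
     exists2 y, S x y & forall z, S y z -> mdist y z <= r) ->
  exists2 xbar, S x0 xbar & S xbar `<=` [set xbar].
Proof.
move=> cX Scl Str Sshrink.
have /choice[step stepP] (q : nat * X) : exists y, S q.2 y /\
    forall z, S y z -> mdist y z <= q.1.+1%:R^-1.
  have [|y Sy yP] := Sshrink q.2 q.1.+1%:R^-1; last by exists y.
  by rewrite invr_gt0 ltr0n.
pose u := fix u n := if n is m.+1 then step (m, u m) else x0.
have u_step n : S (u n) (u n.+1) by have [] := stepP (n, u n).
have u_radius n z : S (u n.+1) z -> mdist (u n.+1) z <= n.+1%:R^-1.
  by have [_] := stepP (n, u n); apply.
have u_later n k : S (u n) (u (n + k).+1).
  elim: k => [|k IHk]; first by rewrite addn0; exact: u_step.
  by rewrite addnS; exact: Str _ _ IHk _ (u_step _).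
have cvg_common z : (forall n, S (u n) z) -> u @ \oo --> z.
  move=> Sz; apply/cvg_ballP => e e0.
  have [N _ NP] := near_infty_natSinv_lt (PosNum e0).
  exists N.+1 => // -[//|n] /= Nn; rewrite ballEmdist /= metric_sym.
  exact: le_lt_trans (u_radius n z (Sz _)) (NP _ Nn).
have [xbar u_xbar] : exists l : X, u @ \oo --> l.
  apply: cX; apply: cauchy_exP => e e0.
  have [N _ NP] := near_infty_natSinv_lt (PosNum e0).
  exists (u N.+1); exists N.+2 => // m /= Nm; rewrite ballEmdist /=.
  have -> : m = (N.+1 + (m - N.+2)).+1 by rewrite -addSn subnKC.
  exact: le_lt_trans (u_radius N _ (u_later _ _)) (NP _ (leqnn N)).
have S_xbar n : S (u n) xbar.
  apply: Scl => B /u_xbar [N _ NB]; exists (u (n + N).+1); split=> //.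
  by apply: NB; rewrite /= -addnS -addSnnS leq_addl.
exists xbar => [|z Sz]; first exact: (S_xbar 0%N).
apply: (cvg_unique (@metric_hausdorff _ X) _ u_xbar).
by apply: cvg_common => n; exact: Str _ _ (S_xbar n) _ Sz.
Qed.

(** * The points reachable from a given point *)

Definition ekeland_set (R : realType) (X : metricType R) (f : X -> cbitv R)
    (eps : R) (x : X) : set X :=
  [set y | cbitv_le (cbitv_add (f y) (cbitv_pt (eps * mdist y x))) (f x)].

(** The triangle inequality: costs of successive moves add up to at least the
    cost of the direct move. *)
Lemma ekeland_set_trans (R : realType) (X : metricType R) (f : X -> cbitv R)
    (eps : R) (x y : X) : 0 <= eps ->
  ekeland_set f eps x y -> ekeland_set f eps y `<=` ekeland_set f eps x.
Proof.
rewrite /ekeland_set => eps0 [/= loy hiy] z [/= loz hiz].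
have := ler_wpM2l eps0 (metric_triangle z y x); rewrite mulrDr => tri.
by split => /=; lra.
Qed.

(** Near a limit point p of the reachable set, the values of f are at most
    f(x) - eps d(p, x) + e. The right-hand side is a translate of the interval
    f(x), so its sublevel set is closed and contains p; then e tends to 0. *)
Lemma closed_ekeland_set (R : realType) (X : metricType R) (f : X -> cbitv R)
    (eps : R) (x : X) : 0 < eps -> cbitv_lsc f -> closed (ekeland_set f eps x).
Proof.
move=> eps0 f_lsc p clp.
have fp e : 0 < e ->
    cbitv_le (f p) (cbitv_add (f x) (cbitv_pt (e - eps * mdist p x))).
  move=> e0; apply: f_lsc => B Bp.
  have Up : nbhs p (B `&` ball p (e / eps)).
    by apply: filterI => //; apply: nbhsx_ballx; exact: divr_gt0.
  have [y [[/= loy hiy] [By]]] := clp _ Up.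
  rewrite ballEmdist /= ltr_pdivlMr// mulrC => py.
  exists y; split=> //.
  have := ler_wpM2l (ltW eps0) (metric_triangle p y x); rewrite mulrDr => tri.
  by split => /=; lra.
by split => /=; apply/ler_addgt0Pr => e /fp[/= lop hip]; lra.
Qed.

(** At a near-minimizer y of the upper endpoint, a further move to z gains at
    most eps r while it costs eps d(y, z). *)
Lemma ekeland_set_shrink (R : realType) (X : metricType R) (f : X -> cbitv R)
    (eps : R) (x : X) (r : R) :
  0 < eps -> cbitv_lower_bounded f -> 0 < r ->
  exists2 y, ekeland_set f eps x y &
    forall z, ekeland_set f eps y z -> mdist y z <= r.
Proof.
move=> eps0 [A fA] r0.
pose H := [set hi (f y) | y in ekeland_set f eps x].
have lbH : has_lbound H by exists (hi A) => _ [y _ <-]; have [] := fA y.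
have infH : has_inf H.
  split=> //; exists (hi (f x)), x => //.
  by split; rewrite /= mdistxx mulr0 addr0.
have [_ [y Sy <-] ylt] := inf_adherent (mulr_gt0 eps0 r0) infH.
exists y => // z yz; rewrite metric_sym -(ler_pM2l eps0).
have zinf : inf H <= hi (f z).
  apply: ge_inf => //; exists z => //.
  exact: ekeland_set_trans (ltW eps0) Sy _ yz.
by have [_ /= hiz] := yz; lra.
Qed.

(** * The variational principle *)

Theorem theorem3p1 (R : realType) (X : metricType R)
  (X_complete : complete_metric X)
  (f : X -> cbitv R)
  (f_lsc : cbitv_lsc f)
  (f_lb : cbitv_lower_bounded f)
  (eps : R) (eps_gt0 : 0 < eps)
  (x0 : X)
  (lo_x0 : lo (f x0) <= inf [set lo (f x) | x in [set: X]] + eps)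
  (hi_x0 : hi (f x0) <= inf [set hi (f x) | x in [set: X]] + eps) :
  exists xbar : X,
    [/\ cbitv_le (f xbar) (f x0),
        mdist x0 xbar <= 1
      & forall x : X, x <> xbar ->
          ~ cbitv_le (cbitv_add (f x) (cbitv_pt (eps * mdist x xbar)))
                     (f xbar)].
Proof.
have [||x r|xbar [/= lo_xbar hi_xbar] xbar_max] :=
  @exists_maximal_of_shrinking R X (ekeland_set f eps) x0 X_complete.
- by move=> x; exact: closed_ekeland_set.
- by move=> x y; apply: ekeland_set_trans; exact: ltW.
- exact: ekeland_set_shrink.
have cost_ge0 : 0 <= eps * mdist xbar x0 by rewrite mulr_ge0 ?mdist_ge0 ?ltW.
exists xbar; split; first by split; lra.
- rewrite metric_sym -(ler_pM2l eps_gt0) mulr1.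
  have inf_le : inf [set hi (f x) | x in [set: X]] <= hi (f xbar).
    have [A fA] := f_lb.
    apply: ge_inf; last by exists xbar.
    by exists (hi A) => _ [y _ <-]; have [] := fA y.
  by lra.
- by move=> x x_neq /xbar_max.
Qed.
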